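(* Let $G_1,\dots,G_n$ be finitely generated groups with a common subgroup $C$ such that each $G_i$ admits a regular positive cone relative to $C$ and $C$ admits a regular positive cone. Let $G$ be the free product of the $G_i$ amalgamated over $C$. Then $G\times\mathbb{Z}$ admits a regular left-order.
   Context: For a group $H$ and subgroup $K$, a positive cone relative to $K$ is a subsemigroup $P\subseteq H$ with $H=P\sqcup K\sqcup P^{-1}$ (disjoint); a positive cone is a positive cone relative to the trivial subgroup. Such a (relative) positive cone of a finitely generated group $H$ is regular if there are a finite set $X$, a surjective monoid homomorphism $\pi\colon X^*\to H$ and a regular language $\mathcal{L}\subseteq X^*$ (accepted by a finite state automaton) with $\pi(\mathcal{L})=P$. A left-order is regular if its positive cone $\{g:1\prec g\}$ is regular. *)

(* Defs.v *)
From mathcomp Require Import all_boot all_algebra.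
Set Implicit Arguments. Unset Strict Implicit. Unset Printing Implicit Defensive.
Import GRing.Theory.

Record group := Group {
  carrier :> Type;
  gmul : carrier -> carrier -> carrier;
  gone : carrier;
  ginv : carrier -> carrier;
  gmulA : forall x y z, gmul x (gmul y z) = gmul (gmul x y) z;
  gmul1 : forall x, gmul gone x = x;
  gmulg1 : forall x, gmul x gone = x;
  gmulV : forall x, gmul (ginv x) x = gone;
  gmulgV : forall x, gmul x (ginv x) = gone
}.

Definition is_hom (G H : group) (f : G -> H) : Prop :=
  forall x y, f (gmul x y) = gmul (f x) (f y).

Definition finitely_generated (H : group) : Prop :=
  exists s : seq H, forall g : H,
    exists w : seq (bool * 'I_(size s)),
      g = foldr (fun (a : bool * 'I_(size s)) acc =>
                   let x := nth (gone H) s a.2 in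
                   gmul (if a.1 then x else ginv x) acc) (gone H) w.

(* P is a positive cone of H relative to the subset K (the image of a subgroup):
   P is a subsemigroup and H = P ⊔ K ⊔ P^{-1} (disjoint) *)
Definition rel_positive_cone (H : group) (K P : H -> Prop) : Prop :=
  (forall x y, P x -> P y -> P (gmul x y)) /\
  (forall g, P g \/ K g \/ P (ginv g)) /\
  (forall g, P g -> ~ K g) /\
  (forall g, P g -> ~ P (ginv g)) /\
  (forall g, K g -> ~ P (ginv g)).

Definition positive_cone (H : group) (P : H -> Prop) : Prop :=
  rel_positive_cone (fun g => g = gone H) P.

Definition regular_language (X : finType) (L : seq X -> Prop) : Prop :=
  exists (Q : finType) (q0 : Q) (delta : Q -> X -> Q) (F : pred Q),
    forall w, L w <-> F (foldl delta q0 w).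

Definition regular_subset (H : group) (P : H -> Prop) : Prop :=
  exists (X : finType) (pi : seq X -> H) (L : seq X -> Prop),
    pi [::] = gone H /\
    (forall u v, pi (u ++ v) = gmul (pi u) (pi v)) /\
    (forall g, exists w, pi w = g) /\
    regular_language L /\
    (forall g, P g <-> exists2 w, L w & pi w = g).

Definition left_order (H : group) (lt : H -> H -> Prop) : Prop :=
  (forall x, ~ lt x x) /\
  (forall x y z, lt x y -> lt y z -> lt x z) /\
  (forall x y, x <> y -> lt x y \/ lt y x) /\
  (forall g x y, lt x y -> lt (gmul g x) (gmul g y)).

Definition regular_left_order (H : group) (lt : H -> H -> Prop) : Prop :=
  left_order lt /\ regular_subset (fun g => lt (gone H) g).

(* ---------- amalgamated free product (universal property) ----------
   Groups Gi : 'I_n -> group with a common subgroup C, given by injective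
   homomorphisms iota i : C -> Gi i.  G together with jC : C -> G and
   j i : Gi i -> G is the free product of the Gi amalgamated over C iff it is
   the colimit of this diagram. *)
Definition amalgamated_free_product (n : nat) (C : group) (Gi : 'I_n -> group)
    (iota : forall i, C -> Gi i) (G : group)
    (jC : C -> G) (j : forall i, Gi i -> G) : Prop :=
  is_hom jC /\ (forall i, is_hom (j i)) /\
  (forall i c, j i (iota i c) = jC c) /\
  forall (H : group) (fC : C -> H) (f : forall i, Gi i -> H),
    is_hom fC -> (forall i, is_hom (f i)) ->
    (forall i c, f i (iota i c) = fC c) ->
    exists h : G -> H,
      [/\ is_hom h, (forall c, h (jC c) = fC c),
          (forall i x, h (j i x) = f i x) &
          (forall h' : G -> H, is_hom h' ->
             (forall c, h' (jC c) = fC c) ->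
             (forall i x, h' (j i x) = f i x) -> forall g, h' g = h g)].

Section ProdZ.
Variable G : group.
Definition pz_mul (a b : G * int) : G * int := (gmul a.1 b.1, (a.2 + b.2)%R).
Definition pz_one : G * int := (gone G, 0%R).
Definition pz_inv (a : G * int) : G * int := (ginv a.1, (- a.2)%R).
Lemma pz_mulA x y z : pz_mul x (pz_mul y z) = pz_mul (pz_mul x y) z.
Proof. by rewrite /pz_mul /= gmulA addrA. Qed.
Lemma pz_mul1 x : pz_mul pz_one x = x.
Proof. by case: x => a m; rewrite /pz_mul /= gmul1 add0r. Qed.
Lemma pz_mulg1 x : pz_mul x pz_one = x.
Proof. by case: x => a m; rewrite /pz_mul /= gmulg1 addr0. Qed.
Lemma pz_mulV x : pz_mul (pz_inv x) x = pz_one.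
Proof. by rewrite /pz_mul /= gmulV addNr. Qed.
Lemma pz_mulgV x : pz_mul x (pz_inv x) = pz_one.
Proof. by rewrite /pz_mul /= gmulgV addrN. Qed.
Definition prodZ : group :=
  @Group (G * int)%type pz_mul pz_one pz_inv pz_mulA pz_mul1 pz_mulg1 pz_mulV pz_mulgV.
End ProdZ.

(* Main.v *)
Require Import Defs.
From mathcomp Require Import all_boot all_algebra.
From mathcomp Require Import boolp zify.

(** Write an element of [G] as a reduced word [x_1 ... x_k c] with [x_l] in [G_(i_l)] outside
    [C] and [c] in [C], and let [tau] be the sum of the signs of the [x_l] with respect to the relative
    cones and of the signs of the [i_(l+1) - i_l]: the signed number of turns along a geodesic of
    the Bass-Serre tree. It is odd outside [C], vanishes on [C], and comparing tripods of the tree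
    shows that it is a quasimorphism of defect [1]. Hence the pairs [(g, m)] with
    [tau g + 2 m > 0], together with the positive cone of [C], form a positive cone of [G x Z].
    After the first syllable each syllable changes [tau] by [-2], [0] or [2], which one letter of
    [Z] compensates at once; so a finite automaton only has to remember the index of the last
    syllable. That [tau] is well defined rests on the normal form theorem, obtained by letting
    [G] act on normal forms (van der Waerden's trick). *)

Set Implicit Arguments. Unset Strict Implicit. Unset Printing Implicit Defensive.

Local Notation "x ** y" := (gmul x y) (at level 40, left associativity).

(** * Elementary identities in groups *)

Section GroupTheory.
Variable H : group.
Implicit Types x y z : H.

Lemma gmulKV x y : ginv x ** (x ** y) = y.
Proof. by rewrite gmulA gmulV gmul1. Qed.

Lemma gmulVK x y : x ** (ginv x ** y) = y.
Proof. by rewrite gmulA gmulgV gmul1. Qed.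

Lemma gmulgK x y : (y ** x) ** ginv x = y.
Proof. by rewrite -gmulA gmulgV gmulg1. Qed.

Lemma gmulgKV x y : (y ** ginv x) ** x = y.
Proof. by rewrite -gmulA gmulV gmulg1. Qed.

Lemma gmulI x : injective (gmul x).
Proof. by move=> y z e; rewrite -(gmulKV x y) e gmulKV. Qed.

Lemma ginv_uniq x y : x ** y = gone H -> ginv x = y.
Proof. by move=> e; apply: (@gmulI x); rewrite gmulgV e. Qed.

Lemma ginvK x : ginv (ginv x) = x.
Proof. by apply: ginv_uniq; rewrite gmulV. Qed.

Lemma ginvM x y : ginv (x ** y) = ginv y ** ginv x.
Proof. by apply: ginv_uniq; rewrite -gmulA gmulVK gmulgV. Qed.

Lemma ginv1 : ginv (gone H) = gone H.
Proof. by apply: ginv_uniq; rewrite gmul1. Qed.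

End GroupTheory.

Lemma hom1 (G H : group) (f : G -> H) : is_hom f -> f (gone G) = gone H.
Proof. by move=> fM; apply: (@gmulI _ (f (gone G))); rewrite -fM gmul1 gmulg1. Qed.

Lemma homV (G H : group) (f : G -> H) x : is_hom f -> f (ginv x) = ginv (f x).
Proof. by move=> fM; apply/esym/ginv_uniq; rewrite -fM gmulgV hom1. Qed.

(** * Rational subsets of a group *)

Section Paths.
Variables (H : group) (Q E : Type) (src tgt : E -> Q).

(** Labels are relations, so that one edge may carry a whole subset of [H]; the runs of an automaton
    are the case of singleton labels. *)
Inductive gpath (lab : E -> H -> Prop) (t : Q) : Q -> H -> Prop :=
| gpath_nil : gpath lab t t (gone H)
| gpath_cons e a g :
    lab e a -> gpath lab t (tgt e) g -> gpath lab t (src e) (a ** g).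

Lemma gpath_step lab t q g e a h :
    src e = q -> lab e a -> gpath lab t (tgt e) h -> g = a ** h ->
  gpath lab t q g.
Proof. by move=> <- la ph ->; apply: gpath_cons. Qed.

Lemma gpath_cat lab t t' q g h :
  gpath lab t q g -> gpath lab t' t h -> gpath lab t' q (g ** h).
Proof.
move=> p p'; elim: p => [|e a x la _ IH]; first by rewrite gmul1.
by rewrite -gmulA; apply: gpath_cons.
Qed.

Lemma gpath_sub (lab lab' : E -> H -> Prop) t q g :
  (forall e a, lab e a -> lab' e a) -> gpath lab t q g -> gpath lab' t q g.
Proof.
by move=> sub; elim=> [|e a x /sub la _ IH]; [apply: gpath_nil | apply: gpath_cons].
Qed.

End Paths.

Lemma gpath_rev (H : group) (Q E : Type) (src tgt : E -> Q)
    (lab : E -> H -> Prop) t q g :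
  gpath src tgt lab t q g ->
  gpath tgt src (fun e a => lab e (ginv a)) q t (ginv g).
Proof.
elim=> [|e a x la _ IH]; first by rewrite ginv1; apply: gpath_nil.
rewrite ginvM; apply: gpath_cat IH _.
apply: (gpath_step (e := e) (a := ginv a) _ _ (gpath_nil _ _ _ _)) => //.
  by rewrite ginvK.
by rewrite gmulg1.
Qed.

(** Nondeterministic, with group elements as labels; an identity label serves as a silent move, so
    one initial and one final state suffice. *)
Record automaton (H : group) := Automaton {
  state : finType;
  edge : finType;
  esrc : edge -> state;
  etgt : edge -> state;
  elab : edge -> H;
  init : state;
  final : state
}.

Definition run (H : group) (A : automaton H) : state A -> H -> Prop :=
  gpath (@esrc _ A) (@etgt _ A) (fun e a => a = elab e) (final A).

Definition rational (H : group) (S : H -> Prop) : Prop :=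
  exists A : automaton H, forall g, S g <-> run (init A) g.

Lemma rational_ext (H : group) (S S' : H -> Prop) :
  (forall g, S g <-> S' g) -> rational S -> rational S'.
Proof. by move=> e [A AP]; exists A => g; rewrite -e. Qed.

Lemma rational_empty (H : group) : rational (fun _ : H => False).
Proof.
pose A := @Automaton H bool void (fun e => match e with end)
  (fun e => match e with end) (fun e => match e with end) true false.
exists A => g; split=> // p; suff: init A = final A by [].
by case: p => // -[].
Qed.

Lemma rational1 (H : group) (a : H) : rational (fun g => g = a).
Proof.
pose A := @Automaton H bool unit (fun=> true) (fun=> false) (fun=> a) true false.
exists A => g; split=> [-> | p].
  by apply: (gpath_step (e := tt) (a := a) _ _ (gpath_nil _ _ _ _)); rewrite ?gmulg1.
pose inv (q : state A) g := g = if q then a else gone H.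
suff: forall q, run (A := A) q g -> inv q g by move/(_ _ p).
move=> q; elim=> // e _ x -> _ ->; exact: gmulg1.
Qed.

Lemma rational_inv (H : group) (S : H -> Prop) :
  rational S -> rational (fun g => S (ginv g)).
Proof.
move=> [A AP].
exists (@Automaton H (state A) (edge A) (@etgt _ A) (@esrc _ A)
          (fun e => ginv (elab e)) (final A) (init A)) => g.
rewrite AP; split=> p; have := gpath_rev p; rewrite ?ginvK;
  apply: gpath_sub => e a /=; first by move=> <-; rewrite ginvK.
by move=> e1; rewrite -(ginvK a) e1 ginvK.
Qed.

(* Substituting rational sets for the edge labels of a finite graph. *)
Lemma rational_gpath (H : group) (Q E : finType) (src tgt : E -> Q)
    (lab : E -> H -> Prop) (s t : Q) :
  (forall e, rational (lab e)) -> rational (gpath src tgt lab t s).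
Proof.
move=> /choice[A AP].
(* Each edge [e] is replaced by a copy of [A e], entered and left by silent edges. *)
pose st := (Q + {e : E & state (A e)})%type.
pose ed := ((E + E) + {e : E & edge (A e)})%type.
pose bsrc (x : ed) : st := match x with
  | inl (inl e) => inl (src e)
  | inl (inr e) => inr (Tagged (fun e => state (A e)) (final (A e)))
  | inr u => inr (Tagged (fun e => state (A e)) (esrc (tagged u)))
  end.
pose btgt (x : ed) : st := match x with
  | inl (inl e) => inr (Tagged (fun e => state (A e)) (init (A e)))
  | inl (inr e) => inl (tgt e)
  | inr u => inr (Tagged (fun e => state (A e)) (etgt (tagged u)))
  end.
pose blab (x : ed) : H := if x is inr u then elab (tagged u) else gone H.
exists (@Automaton H st ed bsrc btgt blab (inl s) (inl t)) => g.
set B := Automaton _ _ _ _ _.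
have inner e q a h : run (A := A e) q a -> run (A := B) (inl (tgt e)) h ->
    run (A := B) (inr (Tagged (fun e => state (A e)) q)) (a ** h).
  move=> p ph; elim: p => [|d _ x -> _ IH].
    by apply: (gpath_step (e := (inl (inr e) : ed)) _ _ ph).
  by apply: (gpath_step (e := (inr (Tagged (fun e => edge (A e)) d) : ed)) _ _ IH);
    rewrite //= gmulA.
split.
  suff: forall q, gpath src tgt lab t q g -> run (A := B) (inl q) g by apply.
  move=> q; elim=> [|e a h /AP la _ IH]; first exact: gpath_nil.
  apply: (gpath_step (e := (inl (inl e) : ed)) (a := gone H) _ _
    (inner _ _ _ _ la IH)) => //.
  by rewrite gmul1.
(* Inside the copy for an edge, what remains to be read splits into the rest of that copy and a path
   from the target of the edge. *)
pose inv (q : st) (g : H) := match q with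
  | inl q => gpath src tgt lab t q g
  | inr u => exists a h, [/\ run (A := A (tag u)) (tagged u) a,
                             gpath src tgt lab t (tgt (tag u)) h & g = a ** h]
  end.
suff: forall q, run (A := B) q g -> inv q g by move/(_ (inl s)).
move=> q; elim=> [|[[e|e]|[e d]] _ x -> _] /=.
- exact: gpath_nil.
- move=> [a [h [/AP la ph ->]]]; rewrite gmul1; exact: gpath_cons.
- move=> p; exists (gone H), x; split=> //; exact: gpath_nil.
- move=> [a [h [p ph ->]]]; exists (elab d ** a), h; rewrite gmulA; split=> //.
  exact: gpath_cons.
Qed.

(** The translation by [b] is one extra edge into a new final state; it will attach a fixed exponent
    of the central generator. *)
Lemma rational_image (G H : group) (f : G -> H) (S : G -> Prop) (b : H) :
  is_hom f -> rational S ->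
  rational (fun h => exists2 g, S g & h = f g ** b).
Proof.
move=> fM [A AP].
pose B := @Automaton H (option (state A)) (option (edge A))
  (fun x => Some (if x is Some e then esrc e else final A))
  (omap (@etgt _ A)) (fun x => if x is Some e then f (elab e) else b)
  (Some (init A)) None.
exists B => h; split=> [[g /AP p ->]|].
  suff main q : run q g -> run (A := B) (Some q) (f g ** b) by exact: main.
  elim=> [|e _ x -> _ IH].
    apply: (gpath_step (e := (None : edge B)) _ (erefl b) (gpath_nil _ _ _ _)) => //.
    by rewrite gmulg1 (hom1 fM) gmul1.
  by apply: (gpath_step (e := (Some e : edge B)) _ _ IH); rewrite //= fM gmulA.
pose inv (q : state B) h := match q with
  | Some q => exists2 g, run q g & h = f g ** b
  | None => h = gone H
  end.
suff: forall q, run (A := B) q h -> inv q h.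
  by move=> /(_ (Some (init A))) i /i [g p ->]; exists g; first exact/AP.
move=> q; elim=> [|[e|] _ x -> _] //=.
- move=> [g p ->]; exists (elab e ** g); first exact: gpath_cons.
  by rewrite fM gmulA.
- move=> ->; exists (gone G); first exact: gpath_nil.
  by rewrite (hom1 fM) gmul1 gmulg1.
Qed.

Section RegularSubset.
Variables (H : group) (P : H -> Prop).

Lemma regular_subset_rational : regular_subset P -> rational P.
Proof.
move=> [X [pi [L [pi0 [piM [_ [[Q [q0 [delta [F LP]]]] PP]]]]]]].
pose A := @Automaton H (option Q) ((Q * X) + Q)%type
  (fun x => match x with
            | inl u => Some u.1
            | inr q => if F q then Some q else None
            end)
  (fun x => if x is inl u then Some (delta u.1 u.2) else None)
  (fun x => if x is inl u then pi [:: u.2] else gone H) (Some q0) None.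
have pi_cons x w : pi (x :: w) = pi [:: x] ** pi w by rewrite -piM.
(* For non-accepting [q] the edge [inr q] is a loop at [None] with trivial label, so runs starting
   at [None] read only the identity. *)
have loop q h : run (A := A) q h -> q = None -> h = gone H.
  elim=> // -[u|r] a x //= -> p IH _; rewrite gmul1; exact: IH.
exists A => g; rewrite PP; split=> [[w /LP Fw <-]|].
  suff main q v : F (foldl delta q v) -> run (A := A) (Some q) (pi v) by exact: main.
  elim: v q => [|x v IH] q /= Fv.
    rewrite pi0; apply: (gpath_step (e := inr q : (Q * X) + Q)
      (a := gone H) _ _ (gpath_nil _ _ _ _)); rewrite ?gmulg1 //=.
    by rewrite Fv.
  by apply: (gpath_step (e := inl (q, x) : (Q * X) + Q) _ _ (IH _ Fv)).
suff: forall q, run (A := A) q g ->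
    if q is Some q then exists2 w, F (foldl delta q w) & pi w = g else True.
  move=> /(_ (Some q0)) i /i [w Fw <-]; exists w => //; exact/LP.
move=> q; elim=> // -[[r x]|r] _ h -> /= p.
  by move=> [w Fw <-]; exists (x :: w).
have /= -> := loop _ _ p erefl.
by case: ifP => // Fr _; exists [::]; rewrite // pi0 gmul1.
Qed.

Lemma regular_subset_rationalT : regular_subset P -> rational (fun _ : H => True).
Proof.
move=> [X [pi [L [pi0 [piM [pi_surj _]]]]]].
pose A := @Automaton H unit X (fun=> tt) (fun=> tt) (fun x => pi [:: x]) tt tt.
exists A => g; split=> // _; have [w <-] := pi_surj g.
elim: w => [|x w IH]; first by rewrite pi0; apply: gpath_nil.
rewrite -cat1s piM; apply: (gpath_step (e := x : edge A) _ _ IH) => //.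
Qed.

End RegularSubset.

(* With the edges themselves as letters the automaton becomes deterministic; [None] is a sink. *)
Lemma rational_regular_subset (H : group) (P : H -> Prop) :
  rational P -> rational (fun _ : H => True) -> regular_subset P.
Proof.
move=> [A AP] [B BP].
(* The edges of [B] are added as letters to make [pi] surjective; [delta] sends them to the sink. *)
pose X := (edge A + edge B)%type.
pose val (x : X) : H := match x with inl e => elab e | inr e => elab e end.
pose pi (w : seq X) : H := foldr (fun x g => val x ** g) (gone H) w.
pose delta (q : option (state A)) (x : X) :=
  if (q, x) is (Some q, inl e) then
    if esrc e == q then Some (etgt e) else None
  else None.
have sink w : foldl delta None w = None by elim: w.
exists X, pi, (fun w => foldl delta (Some (init A)) w == Some (final A)).
split=> //; split; first by elim=> [|x u IH] v /=; rewrite ?gmul1 // IH gmulA.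
split.
  move=> g; elim: ((BP g).1 I) => [|e _ x -> _ [w <-]]; first by exists [::].
  by exists (inr e :: w).
split; first by exists (option (state A) : finType), (Some (init A)), delta,
  (fun q => q == Some (final A)).
move=> g; rewrite AP; split.
  suff main q : run q g -> exists2 w, foldl delta (Some q) w == Some (final A)
    & pi w = g by exact: main.
  elim=> [|e _ x -> _ [w Lw <-]]; first by exists [::].
  by exists (inl e :: w) => //=; rewrite {2}/delta eqxx.
move=> [w Lw <-].
suff main q : foldl delta (Some q) w == Some (final A) -> run q (pi w) by exact: main.
elim: w {Lw} q => [|[e|e] w IH] q; rewrite /= ?{2}/delta.
- by move=> /eqP[->]; apply: gpath_nil.
- case: (esrc e =P q) => [<- /IH|_]; last by rewrite sink.
  exact: gpath_cons.
- by rewrite sink.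
Qed.

(** * Subgroups and symmetric groups, as targets for the universal property *)

Section Subgroup.
Variables (H : group) (S : H -> Prop).
Hypotheses (S1 : S (gone H)) (SM : forall x y, S x -> S y -> S (x ** y)).
Hypothesis SV : forall x, S x -> S (ginv x).

Definition subgroup_mul (x y : {x | S x}) : {x | S x} :=
  exist S (sval x ** sval y) (SM (svalP x) (svalP y)).
Definition subgroup_one : {x | S x} := exist S (gone H) S1.
Definition subgroup_inv (x : {x | S x}) : {x | S x} :=
  exist S (ginv (sval x)) (SV (svalP x)).

Lemma subgroup_eq (x y : {x | S x}) : sval x = sval y -> x = y.
Proof. by case: x y => [x Sx] [y Sy] /= e; apply: eq_exist. Qed.

Definition subgroup : group.
Proof.
refine (@Defs.Group _ subgroup_mul subgroup_one subgroup_inv _ _ _ _ _) => *;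
  apply: subgroup_eq => /=.
- exact: gmulA.
- exact: gmul1.
- exact: gmulg1.
- exact: gmulV.
- exact: gmulgV.
Defined.

End Subgroup.

Section Permutations.
Variable T : Type.

Definition is_perm (p : (T -> T) * (T -> T)) : Prop :=
  cancel p.1 p.2 /\ cancel p.2 p.1.

Lemma perm_mul_subproof p q :
  is_perm p -> is_perm q -> is_perm (p.1 \o q.1, q.2 \o p.2).
Proof. by move=> [pK pK'] [qK qK']; split=> x /=; rewrite ?pK ?qK ?qK' ?pK'. Qed.

Definition perm_mul (p q : {p | is_perm p}) : {p | is_perm p} :=
  exist is_perm _ (perm_mul_subproof (svalP p) (svalP q)).

Definition perm_one : {p | is_perm p} :=
  exist is_perm (id, id) (conj (fun=> erefl) (fun=> erefl)).

Definition perm_inv (p : {p | is_perm p}) : {p | is_perm p} :=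
  exist is_perm ((sval p).2, (sval p).1)
    (conj (svalP p).2 (svalP p).1).

Lemma perm_eq1 (p q : {p | is_perm p}) : (sval p).1 =1 (sval q).1 -> p = q.
Proof.
case: p q => [[f f'] [/= fK f'K]] [[g g'] [/= gK g'K]] /= /funext e.
have e' : f' = g' by apply: funext => x; rewrite -{1}(g'K x) -e fK.
by apply: eq_exist; rewrite e e'.
Qed.

Definition symmetric_group : group.
Proof.
refine (@Defs.Group _ perm_mul perm_one perm_inv _ _ _ _ _) => [p q r|p|p|p|p];
  apply: perm_eq1 => y //=; by case: (svalP p) => pK pK'; rewrite ?pK ?pK'.
Defined.

End Permutations.

(** * Normal forms in an amalgamated free product *)

Section Amalgam.
Variables (n : nat) (C : group) (Gi : 'I_n -> group).
Variable iota : forall i, C -> Gi i.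
Hypothesis iota_hom : forall i, is_hom (iota i).
Hypothesis iota_inj : forall i, injective (iota i).
Variables (G : group) (jC : C -> G) (j : forall i, Gi i -> G).
Hypothesis hG : amalgamated_free_product iota jC j.

Lemma jC_hom : is_hom jC. Proof. by case: hG. Qed.
Lemma j_hom i : is_hom (j (i := i)). Proof. by case: hG => _ []. Qed.
Lemma j_iota i c : j (iota i c) = jC c. Proof. by case: hG => _ [_ []]. Qed.

(** The universal property maps [G] to the subgroup [S]; followed by the inclusion this is the
    identity, by uniqueness. So the factors generate [G]. *)
Lemma amalgam_ind (S : G -> Prop) :
  S (gone G) -> (forall x y, S x -> S y -> S (x ** y)) ->
  (forall x, S x -> S (ginv x)) ->
  (forall c, S (jC c)) -> (forall i (x : Gi i), S (j x)) -> forall g, S g.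
Proof.
move=> S1 SM SV SC Sj g; case: hG => _ [_ [_ univ]].
have [||| h [hM hC hj _]] := univ (subgroup S1 SM SV)
  (fun c => exist S _ (SC c)) (fun i x => exist S _ (Sj i x)).
- by move=> x y; apply: subgroup_eq; apply: jC_hom.
- by move=> i x y; apply: subgroup_eq; apply: j_hom.
- by move=> i c; apply: subgroup_eq; apply: j_iota.
have [h0 [_ _ _ uniq]] := univ G jC j jC_hom j_hom j_iota.
have e : sval (h g) = g.
  rewrite (uniq (fun g => sval (h g))) -?(uniq id) //.
  - by move=> x y; rewrite hM.
  - by move=> c; rewrite hC.
  - by move=> i x; rewrite hj.
by rewrite -e; apply: svalP.
Qed.

(** Actions of the factors that agree on [C] are compatible homomorphisms to the symmetric group of
    [T]. *)
Lemma amalgam_action (T : Type) (aC : C -> T -> T) (a : forall i, Gi i -> T -> T) :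
  (forall t, aC (gone C) t = t) ->
  (forall x y t, aC (x ** y) t = aC x (aC y t)) ->
  (forall i t, a i (gone (Gi i)) t = t) ->
  (forall i x y t, a i (x ** y) t = a i x (a i y t)) ->
  (forall i c t, a i (iota i c) t = aC c t) ->
  exists r : G -> T -> T,
    [/\ forall x y t, r (x ** y) t = r x (r y t),
        forall c t, r (jC c) t = aC c t &
        forall i (x : Gi i) t, r (j x) t = a i x t].
Proof.
move=> aC1 aCM a1 aM aiota.
have pC c : is_perm (aC c, aC (ginv c)).
  by split=> t /=; rewrite -aCM ?gmulV ?gmulgV aC1.
have p i x : is_perm (a i x, a i (ginv x)).
  by split=> t /=; rewrite -aM ?gmulV ?gmulgV a1.
case: hG => _ [_ [_ univ]].
have [||| h [hM hC hj _]] := univ (symmetric_group T)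
  (fun c => exist (@is_perm T) _ (pC c))
  (fun i x => exist (@is_perm T) _ (p i x)).
- by move=> x y; apply: perm_eq1 => t /=; apply: aCM.
- by move=> i x y; apply: perm_eq1 => t /=; apply: aM.
- by move=> i c; apply: perm_eq1 => t /=; apply: aiota.
exists (fun g => (sval (h g)).1); split.
- by move=> x y t; rewrite hM.
- by move=> c t; rewrite hC.
- by move=> i x t; rewrite hj.
Qed.

(** * Cosets of [C], reduced words and van der Waerden's action *)

Definition inC i (x : Gi i) : Prop := exists c, iota i c = x.

Lemma inCM i (x y : Gi i) : inC x -> inC y -> inC (x ** y).
Proof. by move=> [c <-] [d <-]; exists (c ** d); rewrite iota_hom. Qed.

Lemma inCV i (x : Gi i) : inC x -> inC (ginv x).
Proof. by move=> [c <-]; exists (ginv c); rewrite (homV _ (iota_hom i)). Qed.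

Lemma inCVE i (x : Gi i) : inC (ginv x) <-> inC x.
Proof. by split=> /inCV; rewrite ?ginvK. Qed.

Lemma inC_mull i (x y : Gi i) : inC x -> (inC (x ** y) <-> inC y).
Proof.
move=> Cx; split=> [Cxy|]; last exact: inCM.
by rewrite -(gmulKV x y); apply: inCM => //; apply: inCV.
Qed.

Lemma inC_mulr i (x y : Gi i) : inC y -> (inC (x ** y) <-> inC x).
Proof.
move=> Cy; split=> [Cxy|Cx]; last exact: inCM.
by rewrite -(gmulgK y x); apply: inCM => //; apply: inCV.
Qed.

Notation letter := {i : 'I_n & Gi i}.
Implicit Types (l u v : seq letter) (t : letter).

Definition hd l : option 'I_n := if l is t :: _ then Some (tag t) else None.

Fixpoint reduced l : Prop :=
  if l is t :: l' then [/\ ~ inC (tagged t), hd l' <> Some (tag t) & reduced l']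
  else True.

Definition ev l : G := foldr (fun t g => j (tagged t) ** g) (gone G) l.

(** The representative is chosen from the coset [C x] as a set, so it depends on that set alone; the
    coset [C] itself gets the identity. *)
Lemma transversal_exists i : exists rc : (Gi i -> Gi i) * (Gi i -> C),
  [/\ forall x, iota i (rc.2 x) ** rc.1 x = x,
      forall c x, rc.1 (iota i c ** x) = rc.1 x &
      forall x, inC x <-> rc.1 x = gone (Gi i)].
Proof.
have /choice[f fP] (S : Gi i -> Prop) : exists x, (exists y, S y) -> S x.
  have [[x Sx]|nS] := pselect (exists x, S x); first by exists x.
  by exists (gone (Gi i)).
pose coset x y := exists c, iota i c ** y = x.
pose r x := if pselect (inC x) then gone (Gi i) else f (coset x).
have rP x : coset x (r x).
  rewrite /r; case: pselect => [[c e]|_] /=; first by exists c; rewrite gmulg1.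
  by apply: fP; exists x, (gone C); rewrite (hom1 (iota_hom i)) gmul1.
have [s sP] := choice rP.
exists (r, s); split=> //= [c x|x].
  have Cc : inC (iota i c) by exists c.
  rewrite /r; case: pselect => C1; case: pselect => C2 //=.
  - by case: C2; apply/(inC_mull _ Cc).
  - by case: C1; apply/(inC_mull _ Cc).
  congr (f _); apply/predeqP => y; split=> -[d].
    move=> e; exists (ginv c ** d); rewrite iota_hom -gmulA e.
    by rewrite (homV _ (iota_hom i)) gmulKV.
  by move=> <-; exists (c ** d); rewrite iota_hom gmulA.
split=> [Cx|rx]; first by rewrite /r; case: pselect.
by exists (s x); rewrite -[RHS]sP rx gmulg1.
Qed.

Definition coset_rep i : Gi i -> Gi i := (sval (cid (transversal_exists i))).1.
Definition coset_part i : Gi i -> C := (sval (cid (transversal_exists i))).2.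

Lemma coset_partK i (x : Gi i) : iota i (coset_part x) ** coset_rep x = x.
Proof. by rewrite /coset_part /coset_rep; case: cid => rc [] /=. Qed.

Lemma coset_repM i c (x : Gi i) : coset_rep (iota i c ** x) = coset_rep x.
Proof. by rewrite /coset_rep; case: cid => rc [] /=. Qed.

Lemma coset_rep1 i (x : Gi i) : inC x <-> coset_rep x = gone (Gi i).
Proof. by rewrite /coset_rep; case: cid => rc [] /=. Qed.

Lemma coset_partM i c (x : Gi i) : coset_part (iota i c ** x) = c ** coset_part x.
Proof.
apply: (@iota_inj i); rewrite iota_hom.
have := coset_partK (iota i c ** x); rewrite coset_repM -{3}(coset_partK x) gmulA.
by move/(congr1 (fun y => y ** ginv (coset_rep x))); rewrite !gmulgK.
Qed.

Lemma coset_rep_id i (x : Gi i) : coset_rep (coset_rep x) = coset_rep x.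
Proof. by rewrite -(coset_repM (coset_part x)) coset_partK. Qed.

Lemma coset_part_fix i (x : Gi i) : coset_rep x = x -> coset_part x = gone C.
Proof.
move=> e; apply: (@iota_inj i); rewrite (hom1 (iota_hom i)).
have := coset_partK x; rewrite e => /(congr1 (fun y => y ** ginv x)).
by rewrite gmulgK gmulgV.
Qed.

Lemma coset_part_iota i c : coset_part (iota i c) = c.
Proof.
apply: (@iota_inj i); rewrite -[RHS]coset_partK.
by rewrite (proj1 (coset_rep1 (iota i c))) ?gmulg1 //; exists c.
Qed.

(** Unlike in [word_of], the factor from [C] stands to the left here: [(c, l)] encodes [c] times a
    product of right coset representatives. *)
Fixpoint normal l : Prop :=
  if l is t :: l' then
    [/\ ~ inC (tagged t), coset_rep (tagged t) = tagged t,
        hd l' <> Some (tag t) & normal l']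
  else True.

Definition pull i t : Gi i :=
  if tag t =P i is ReflectT e then ecast i (Gi i) e (tagged t) else gone (Gi i).

Lemma pullE i (x : Gi i) : pull i (Tagged Gi x) = x.
Proof. by rewrite /pull; case: eqP => // e; rewrite eq_axiomK. Qed.

(* [split_head i] and [join_head i] are inverse bijections between the normal forms and
   [G_i] times the normal forms not starting in [G_i]; [G_i] acts on the first factor. *)
Definition split_head i (w : C * seq letter) : Gi i * seq letter :=
  if w.2 is t :: l then
    if tag t == i then (iota i w.1 ** pull i t, l) else (iota i w.1, w.2)
  else (iota i w.1, [::]).

Definition join_head i (w : Gi i * seq letter) : C * seq letter :=
  if pselect (inC w.1) then (coset_part w.1, w.2)
  else (coset_part w.1, Tagged Gi (coset_rep w.1) :: w.2).

Lemma split_head_normal i c l : normal l ->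
  normal (split_head i (c, l)).2 /\ hd (split_head i (c, l)).2 <> Some i.
Proof.
case: l => [|t l] //= [Ct rt hl nl]; rewrite /split_head /=.
by case: eqP => [<-|ne] //=; split=> // -[].
Qed.

Lemma coset_rep_inC i (x : Gi i) : inC (coset_rep x) <-> inC x.
Proof. by rewrite coset_rep1 coset_rep_id -coset_rep1. Qed.

Lemma join_head_normal i (x : Gi i) l :
  normal l -> hd l <> Some i -> normal (join_head (x, l)).2.
Proof.
move=> nl hl; rewrite /join_head; case: pselect => //= nC; split=> //.
  by rewrite coset_rep_inC.
exact: coset_rep_id.
Qed.

Lemma join_headK i (x : Gi i) l :
  hd l <> Some i -> split_head i (join_head (x, l)) = (x, l).
Proof.
move=> hl; rewrite /join_head; case: pselect => /= Cx.
  have ex : iota i (coset_part x) = x.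
    by rewrite -{2}(coset_partK x) (proj1 (coset_rep1 x) Cx) gmulg1.
  case: l hl => [|t l] hl; rewrite /split_head /= ex //.
  by case: eqP => // e; case: hl; rewrite /= e.
by rewrite /split_head /= eqxx pullE coset_partK.
Qed.

Lemma split_headK i c l : normal l -> join_head (split_head i (c, l)) = (c, l).
Proof.
have iotaC : inC (iota i c) by exists c.
case: l => [|[i' x] l] /=.
  by rewrite /join_head /split_head /= coset_part_iota; case: pselect.
move=> [Cx rx hl nl]; rewrite /split_head /=; case: eqP => [e|ne].
  subst i'; rewrite (pullE x) /join_head /= coset_repM coset_partM.
  rewrite rx (coset_part_fix rx) gmulg1.
  by case: pselect => //= C1; case: Cx; apply/(inC_mull _ iotaC).
by rewrite /join_head /= coset_part_iota; case: pselect.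
Qed.

(** Left multiplication on the factor [Gi i] of the splitting. Lists that are not normal are fixed,
    which makes this an action on the full type. *)
Definition act i (x : Gi i) (w : C * seq letter) : C * seq letter :=
  if pselect (normal w.2) then
    join_head (x ** (split_head i w).1, (split_head i w).2)
  else w.

Definition actC (c : C) (w : C * seq letter) : C * seq letter :=
  if pselect (normal w.2) then (c ** w.1, w.2) else w.

Lemma act_normal i (x : Gi i) w : normal w.2 -> normal (act x w).2.
Proof.
case: w => c l /= nl; rewrite /act; case: pselect => //= _.
by have [? ?] := split_head_normal i c nl; apply: join_head_normal.
Qed.

Lemma act1 i w : act (gone (Gi i)) w = w.
Proof.
case: w => c l; rewrite /act; case: pselect => //= nl.
by rewrite gmul1 -surjective_pairing split_headK.
Qed.

Lemma actE i (x : Gi i) w : normal w.2 ->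
  act x w = join_head (x ** (split_head i w).1, (split_head i w).2).
Proof. by rewrite /act; case: pselect. Qed.

Lemma actM i (x y : Gi i) w : act (x ** y) w = act x (act y w).
Proof.
have [nw|nw] := pselect (normal w.2); last first.
  have out z : act z w = w by rewrite /act; case: pselect.
  by rewrite !out.
rewrite (actE x (act_normal y nw)) !(actE _ nw); case: w nw => c l nl.
have [? ?] := split_head_normal i c nl.
by rewrite join_headK //= gmulA.
Qed.

Lemma act_iota i c w : act (iota i c) w = actC c w.
Proof.
case: w => d l; rewrite /act /actC; case: pselect => //= nl.
have -> : iota i c ** (split_head i (d, l)).1 = (split_head i (c ** d, l)).1.
  rewrite /split_head; case: l nl => [|t l] /= _; rewrite ?iota_hom //.
  by case: ifP => _ /=; rewrite ?gmulA.
have -> : (split_head i (d, l)).2 = (split_head i (c ** d, l)).2.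
  by rewrite /split_head; case: l nl => [|t l] //= _; case: ifP.
by rewrite -surjective_pairing split_headK.
Qed.

(** [r g] is the image of the empty normal form under [g]. Each letter of a reduced word acts by
    prepending a syllable of its own index. *)
Lemma normal_form : exists r : G -> C * seq letter,
  (forall c, r (jC c) = (c, [::])) /\
  forall l, reduced l -> hd (r (ev l)).2 = hd l.
Proof.
have [||||| r [rM rC rj]] := @amalgam_action _ actC act.
- by move=> [c l]; rewrite /actC; case: pselect => //= _; rewrite gmul1.
- move=> x y [c l]; have [nl|nl] := pselect (normal l).
    have inn z d : actC z (d, l) = (z ** d, l) by rewrite /actC; case: pselect.
    by rewrite !inn gmulA.
  have out z : actC z (c, l) = (c, l) by rewrite /actC; case: pselect.
  by rewrite !out.
- exact: act1.
- exact: actM.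
- exact: act_iota.
have rC1 c : r (jC c) (gone C, [::]) = (c, [::]).
  by rewrite rC /actC; case: pselect => //= _; rewrite gmulg1.
exists (fun g => r g (gone C, [::])); split=> // l.
suff: reduced l -> hd (r (ev l) (gone C, [::])).2 = hd l /\
                   normal (r (ev l) (gone C, [::])).2 by move=> i /i [].
elim: l => [|[i x] l IH] /=; first by rewrite -(hom1 jC_hom) rC1.
move=> [Cx hl /IH]; rewrite rM rj; case: (r _ _) => c m /= [hm nm].
rewrite /act; case: pselect => //= _.
(* The head of [m] has an index other than [i], so there is no syllable to merge with. *)
have -> : split_head i (c, m) = (iota i c, m).
  rewrite /split_head /=; case: m hm nm => //= t m hm _.
  by case: eqP => // e; case: hl; rewrite -hm e.
have nCx : ~ inC (x ** iota i c) by rewrite inC_mulr //; exists c.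
rewrite /join_head /=; case: pselect => //= _; split=> //; split.
- by rewrite coset_rep_inC.
- exact: coset_rep_id.
- by rewrite hm.
- by [].
Qed.

Lemma reduced_jC l c : reduced l -> ev l = jC c -> l = [::].
Proof.
have [r [rC rev]] := normal_form.
by move=> /rev + e; rewrite e rC; case: l {e}.
Qed.

Lemma jC_inj : injective jC.
Proof.
have [r [rC _]] := normal_form.
by move=> x y e; have := rC x; rewrite e rC => -[].
Qed.

(** * Signs with respect to the relative cones *)

Section Cones.
Local Open Scope ring_scope.
Import GRing.Theory.
Variable P : forall i, Gi i -> Prop.
Hypothesis coneP : forall i, rel_positive_cone (@inC i) (@P i).

Lemma coneM i (x y : Gi i) : P x -> P y -> P (x ** y).
Proof. by have [+ _] := coneP i; apply. Qed.

Lemma cone_trichotomy i (x : Gi i) : P x \/ inC x \/ P (ginv x).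
Proof. by have [_ [+ _]] := coneP i; apply. Qed.

Lemma cone_notC i (x : Gi i) : P x -> ~ inC x.
Proof. by have [_ [_ [+ _]]] := coneP i; apply. Qed.

Lemma cone_asym i (x : Gi i) : P x -> ~ P (ginv x).
Proof. by have [_ [_ [_ [+ _]]]] := coneP i; apply. Qed.

(** The other cases of the trichotomy fail: one puts [x] in [C], the other makes [ginv c] a product
    of two elements of the cone. *)
Lemma coneMC i (x c : Gi i) : P x -> inC c -> P (x ** c).
Proof.
move=> Px Cc; have [//|[Cxc|Pi]] := cone_trichotomy (x ** c).
  by case: (cone_notC Px); apply/(inC_mulr x Cc).
case: (cone_notC (coneM Pi Px)); rewrite ginvM gmulgKV; exact: inCV.
Qed.

Lemma coneCM i (x c : Gi i) : P x -> inC c -> P (c ** x).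
Proof.
move=> Px Cc; have [//|[Ccx|Pi]] := cone_trichotomy (c ** x).
  by case: (cone_notC Px); apply/(inC_mull x Cc).
case: (cone_notC (coneM Px Pi)); rewrite ginvM gmulVK; exact: inCV.
Qed.

Definition sg i (x : Gi i) : int :=
  if pselect (P x) then 1 else if pselect (P (ginv x)) then -1 else 0.

Lemma sg_pos i (x : Gi i) : P x -> sg x = 1.
Proof. by rewrite /sg; case: pselect. Qed.

Lemma sg_neg i (x : Gi i) : P (ginv x) -> sg x = -1.
Proof.
move=> Pi; rewrite /sg; case: pselect => /= [Px|_]; first by case: (cone_asym Px).
by case: pselect.
Qed.

Lemma sgC i (x : Gi i) : inC x -> sg x = 0.
Proof.
move=> Cx; rewrite /sg; case: pselect => /= [Px|_]; first by case: (cone_notC Px).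
by case: pselect => //= Px; case: (cone_notC Px); apply: inCV.
Qed.

Lemma sgV i (x : Gi i) : sg (ginv x) = - sg x.
Proof.
have [Px|[Cx|Px]] := cone_trichotomy x.
- by rewrite sg_neg ?ginvK // (sg_pos Px).
- by rewrite !sgC ?oppr0 //; apply: inCV.
- by rewrite sg_pos // (sg_neg Px) opprK.
Qed.

Lemma sgMC i (x c : Gi i) : inC c -> sg (x ** c) = sg x.
Proof.
move=> Cc; have [Px|[Cx|Px]] := cone_trichotomy x.
- by rewrite !sg_pos //; apply: coneMC.
- by rewrite !sgC //; apply: inCM.
- by rewrite !sg_neg // ginvM; apply: coneCM => //; apply: inCV.
Qed.

Lemma sgCM i (x c : Gi i) : inC c -> sg (c ** x) = sg x.
Proof.
move=> Cc; apply: oppr_inj; rewrite -!sgV ginvM sgMC //; exact: inCV.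
Qed.

Lemma sg_range i (x : Gi i) : (-1 <= sg x <= 1)%R.
Proof. by rewrite /sg; case: pselect => //= _; case: pselect. Qed.

(** Opposite signs cancel, equal signs are inherited by the product because [P] is a semigroup, and
    factors in [C] change nothing. *)
Lemma sgM_bound i (x y : Gi i) : (-1 <= sg (x ** y) - sg x - sg y <= 1)%R.
Proof.
have bxy := sg_range (x ** y).
have [Px|[Cx|Px]] := cone_trichotomy x; last 1 first.
- have [Py|[Cy|Py]] := cone_trichotomy y.
  + by rewrite (sg_neg Px) (sg_pos Py); lia.
  + by rewrite sgMC // (sgC Cy) subr0 subrr.
  + by rewrite (sg_neg Px) (sg_neg Py) sg_neg // ginvM; apply: coneM.
- have [Py|[Cy|Py]] := cone_trichotomy y.
  + by rewrite (sg_pos Px) (sg_pos Py) sg_pos //; apply: coneM.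
  + by rewrite sgMC // (sgC Cy) subr0 subrr.
  + by rewrite (sg_pos Px) (sg_neg Py); lia.
- by rewrite sgCM // (sgC Cx) subr0 subrr.
Qed.

(** * Turns, and their sum along reduced words *)

Definition turn (a b : option 'I_n) : int :=
  if (a, b) is (Some i, Some k) then
    if (i < k)%N then 1 else if (k < i)%N then -1 else 0
  else 0.
Arguments turn : simpl never.

Lemma turnN a b : turn b a = - turn a b.
Proof.
case: a b => [i|] [k|]; rewrite /turn ?oppr0 //.
by case: ltngtP; rewrite ?oppr0 ?opprK.
Qed.

Lemma turnx0 a : turn a None = 0.
Proof. by case: a. Qed.

(** This is the sum of the turns around the cycle [i], [b], [a]; in a linear order the three signs
    cannot all agree. If [a] or [b] is [None], the end of a word, a single turn is left. *)
Lemma turn_tripod i a b : a <> Some i -> b <> Some i -> a <> b ->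
  (-1 <= turn (Some i) b - turn (Some i) a - turn a b <= 1)%R.
Proof.
have ne (x y : 'I_n) : Some x <> Some y -> x <> y :> nat.
  by move=> nxy exy; case: nxy; congr Some; apply: val_inj.
case: a b => [a|] [b|] //.
- move=> /ne nai /ne nbi /ne nab; rewrite /turn.
  by case: (ltngtP i b) => ib; case: (ltngtP i a) => ia;
    case: (ltngtP a b) => ab //; lia.
- by move=> _ _ _; rewrite /turn; case: (ltngtP i a).
- by move=> _ _ _; rewrite /turn; case: (ltngtP i b).
Qed.

Lemma turn_odd i k : Some k <> Some i ->
  turn (Some i) (Some k) = 1 \/ turn (Some i) (Some k) = -1.
Proof.
move=> ne; rewrite /turn; case: ltngtP => [||e]; [by left|by right|].
by case: ne; congr Some; apply: val_inj.
Qed.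

(* The sum of the signs of the turns along the geodesic from [C] to [ev l C] in the
   Bass-Serre tree. *)
Fixpoint tau l : int :=
  if l is t :: l' then sg (tagged t) + turn (Some (tag t)) (hd l') + tau l' else 0.

Fixpoint inv_cat u v : seq letter :=
  if u is t :: u' then inv_cat u' (Tagged Gi (ginv (tagged t)) :: v) else v.

(** Distinct first indices prevent cancellation at the junction. Reversing [u] negates its turns,
    and the junction adds one. *)
Lemma inv_catP u v : reduced u -> reduced v -> hd u <> hd v ->
  [/\ reduced (inv_cat u v), ev (inv_cat u v) = ginv (ev u) ** ev v,
      tau (inv_cat u v) = tau v - tau u + turn (hd u) (hd v) &
      size (inv_cat u v) = (size u + size v)%N].
Proof.
elim: u v => [|[i x] u IH] v /=; first by rewrite ginv1 gmul1 subr0 addr0.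
move=> [Cx hu ru] rv hv.
have rv' : reduced (Tagged Gi (ginv x) :: v).
  by split=> //=; [rewrite inCVE | move=> e; case: hv].
have [? -> -> ->] := IH _ ru rv' hu.
split=> //=.
- by rewrite ginvM (homV _ (j_hom (i := i))) gmulA.
- rewrite sgV (turnN (Some i) (hd u)); lia.
- by rewrite addnS.
Qed.

Definition scale c v : seq letter :=
  if v is t :: v' then Tagged Gi (iota (tag t) c ** tagged t) :: v' else [::].

(** The first letter absorbs [c] without changing its sign; past an empty word [c] moves to the
    right, which is why [d] appears. *)
Lemma scaleP c v : reduced v ->
  [/\ reduced (scale c v), hd (scale c v) = hd v, tau (scale c v) = tau v &
      exists d, jC c ** ev v = ev (scale c v) ** jC d].
Proof.
case: v => [|[i x] v] /=.
  by split=> //; exists c; rewrite gmul1 gmulg1.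
have Cc : inC (iota i c) by exists c.
move=> [Cx hv rv]; split=> //.
- by split=> //; rewrite inC_mull.
- by rewrite sgCM.
- by exists (gone C); rewrite (hom1 jC_hom) gmulg1 j_hom j_iota gmulA.
Qed.

(** Here [l] spells the quotient of two words with heads [a] and [b]. If the heads differ, the
    geodesics branch at the base vertex and the formula is exact; otherwise they branch later, at
    the cost of a defect of at most 1. *)
Definition tripod (a b : option 'I_n) (tu tv : int) l : Prop :=
  if a == b then (-1 <= tv - tu - tau l <= 1)%R /\ (l = [::] -> tv = tu)
  else tau l = tv - tu + turn a b /\ l <> [::].

Lemma hd_nil l : hd l = None -> l = [::].
Proof. by case: l. Qed.

(* Follow the two geodesics from the base vertex until they branch. *)
Lemma ev_div u v : reduced u -> reduced v -> exists l d,
  [/\ reduced l, ginv (ev u) ** ev v = ev l ** jC d &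
      tripod (hd u) (hd v) (tau u) (tau v) l].
Proof.
elim: u v => [|[i x] u IH] v ru rv.
  exists v, (gone C); rewrite (hom1 jC_hom) gmulg1 ginv1 gmul1; split=> //.
  by rewrite /tripod; case: v rv => [|t v] _ //=; rewrite subr0 addr0.
have [hv|hv] := eqVneq (hd (Tagged Gi x :: u)) (hd v); last first.
  have [rl el tl sl] := inv_catP ru rv (elimN eqP hv).
  exists (inv_cat (Tagged Gi x :: u) v), (gone C).
  rewrite (hom1 jC_hom) gmulg1; split=> //; rewrite /tripod (negPf hv); split=> //.
  by move=> e; move: sl; rewrite e.
case: v rv hv => [//|[i' y] v] rv [e]; subst i'.
case: ru rv => /= [Cx hu ru] [Cy hv rv].
have evz : ginv (j x ** ev u) ** (j y ** ev v) =
    ginv (ev u) ** (j (ginv x ** y) ** ev v).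
  by rewrite ginvM j_hom (homV _ (j_hom (i := i))) !gmulA.
have := sgM_bound x (ginv x ** y); rewrite gmulVK => bz.
rewrite /tripod eqxx.
(* Both geodesics enter the vertex [Gi i]. If [ginv x ** y] is outside [C] they branch there, and
   [sgM_bound] gives the defect. *)
have [Cz|Cz] := pselect (inC (ginv x ** y)); last first.
  have rz : reduced (Tagged Gi (ginv x ** y) :: v) by [].
  have [rl el tl sl] := inv_catP ru rz hu.
  exists (inv_cat u (Tagged Gi (ginv x ** y) :: v)), (gone C).
  rewrite (hom1 jC_hom) gmulg1 evz el; split=> //; split.
    rewrite tl /= (turnN (Some i) (hd u)); lia.
  by move=> e; move: sl; rewrite e /= addnS.
(* Otherwise they leave through the same coset of [C] with equal signs; [v] absorbs the element of
   [C] and the induction continues. *)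
have sxy : sg y = sg x by rewrite -(gmulVK x y) sgMC.
case: Cz => c ec; have [rs hs ts [d ed]] := scaleP c rv.
have [l [d' [rl el]]] := IH _ ru rs.
exists l, (d' ** d); split=> //.
  by rewrite evz -ec j_iota ed gmulA el jC_hom gmulA.
(* Either the tails still agree and the defect is passed on, or they branch at this coset of [C],
   where [turn_tripod] bounds it. *)
move: p; rewrite /tripod hs ts sxy; case: eqP => [<-|ne] [tl nl].
  by split; [lia | move=> /nl; lia].
by split=> //; have := turn_tripod hu hv ne; lia.
Qed.

(** * The quasimorphism on [G] *)

Definition word_of g l : Prop := reduced l /\ exists c, g = ev l ** jC c.

Lemma word_of_jC c : word_of (jC c) [::].
Proof. by split=> //; exists c; rewrite gmul1. Qed.

Lemma word_of1 : word_of (gone G) [::].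
Proof. by rewrite -(hom1 jC_hom); apply: word_of_jC. Qed.

Lemma word_of_scale c g l : word_of g l -> word_of (jC c ** g) (scale c l).
Proof.
move=> [rl [d ->]]; have [rs _ _ [e ee]] := scaleP c rl; split=> //.
by exists (e ** d); rewrite gmulA ee jC_hom gmulA.
Qed.

Lemma word_of_mulC c g l : word_of g l -> word_of (g ** jC c) l.
Proof. by move=> [rl [d ->]]; split=> //; exists (d ** c); rewrite jC_hom gmulA. Qed.

Lemma word_of_div g h u v : word_of g u -> word_of h v ->
  exists2 l, word_of (ginv g ** h) l & tripod (hd u) (hd v) (tau u) (tau v) l.
Proof.
move=> [ru [c ->]] [rv [d ->]]; have [l [e [rl el tl]]] := ev_div ru rv.
have [_ hs ts _] := scaleP (ginv c) rl.
exists (scale (ginv c) l).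
  have -> : ginv (ev u ** jC c) ** (ev v ** jC d) =
      jC (ginv c) ** (ev l ** jC (e ** d)).
    by rewrite ginvM (homV _ jC_hom) jC_hom !gmulA -(gmulA _ _ (ev v)) el !gmulA.
  by apply: word_of_scale; split=> //; exists (e ** d).
move: tl; rewrite /tripod ts; case: eqP => _ [tl nl]; split=> // e0.
  by apply/nl/hd_nil; rewrite -hs e0.
by apply/nl/hd_nil; rewrite -hs e0.
Qed.

(** By [word_of_div] the elements with a word are closed under quotients, hence form a subgroup, and
    it contains the generators. *)
Lemma word_exists g : exists l, word_of g l.
Proof.
have inv x : (exists l, word_of x l) -> exists l, word_of (ginv x) l.
  move=> [u xu]; have [l] := word_of_div xu word_of1.
  by rewrite gmulg1; exists l.
elim/amalgam_ind: g => [|x y /inv[u xu] [v yv]|x /inv //|c|i x].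
- by exists [::]; apply: word_of1.
- by have [l] := word_of_div xu yv; rewrite ginvK; exists l.
- by exists [::]; apply: word_of_jC.
- have [[c <-]|Cx] := pselect (inC x).
    by exists [::]; rewrite j_iota; apply: word_of_jC.
  exists [:: Tagged Gi x]; split=> //; exists (gone C).
  by rewrite (hom1 jC_hom) /= !gmulg1.
Qed.

Lemma word_of_nil g l c : word_of g l -> g = jC c -> l = [::].
Proof.
move=> [rl [d ->]] e; apply: (reduced_jC (c := c ** ginv d)) => //.
by rewrite jC_hom -e (homV _ jC_hom) gmulgK.
Qed.

(** The word of the quotient represents the identity, so it is empty by the normal form theorem;
    [tripod] then forces equality. *)
Lemma word_of_tau g u v : word_of g u -> word_of g v -> tau u = tau v.
Proof.
move=> gu gv; have [l] := word_of_div gu gv; rewrite gmulV => /word_of_nil l0.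
have {}l0 : l = [::] by apply: (l0 (gone C)); rewrite (hom1 jC_hom).
by rewrite /tripod; case: eqP => _ [tl nl]; [rewrite nl | case: nl].
Qed.

Definition gtau g : int := tau (sval (cid (word_exists g))).

Lemma gtauE g l : word_of g l -> gtau g = tau l.
Proof. by rewrite /gtau; case: cid => u gu; apply: word_of_tau. Qed.

Lemma gtau_jC c : gtau (jC c) = 0.
Proof. by rewrite (gtauE (word_of_jC c)). Qed.

Lemma gtau_mulC g c : gtau (g ** jC c) = gtau g.
Proof. by have [l gl] := word_exists g; rewrite (gtauE gl) (gtauE (word_of_mulC c gl)). Qed.

Lemma gtau_Cmul g c : gtau (jC c ** g) = gtau g.
Proof.
have [l gl] := word_exists g; rewrite (gtauE gl) (gtauE (word_of_scale c gl)).
by case: gl => rl _; have [] := scaleP c rl.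
Qed.

Lemma gtau_inv g : gtau (ginv g) = - gtau g.
Proof.
have [u gu] := word_exists g; have [l] := word_of_div gu word_of1.
rewrite gmulg1 => gl; rewrite (gtauE gu) (gtauE gl) /tripod turnx0.
case: eqP => [/hd_nil u0 _|_ [->]]; last by rewrite sub0r addr0.
case: gu => _ [c]; rewrite u0 gmul1 => gc.
by rewrite (@word_of_nil _ l (ginv c) gl) ?oppr0 // (homV _ jC_hom) gc.
Qed.

Lemma gtau_div_bound g h : (-1 <= gtau h - gtau g - gtau (ginv g ** h) <= 1)%R.
Proof.
have [u gu] := word_exists g; have [v hv] := word_exists h.
have [l gl] := word_of_div gu hv; rewrite (gtauE gu) (gtauE hv) (gtauE gl) /tripod.
case: eqP => _ [tl _] //; rewrite tl.
have : (-1 <= turn (hd u) (hd v) <= 1)%R; last lia.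
by rewrite /turn; case: (hd u) (hd v) => [?|] [?|] //; do !case: ifP.
Qed.

Lemma gtauM_bound g h : (-1 <= gtau (g ** h) - gtau g - gtau h <= 1)%R.
Proof. by have := gtau_div_bound (ginv g) h; rewrite ginvK gtau_inv; lia. Qed.

(** A word of [k] letters has [k] signs and [k - 1] turns, each equal to 1 or -1. *)
Lemma tau_odd l : reduced l -> l <> [::] -> exists k : int, tau l = 2 * k + 1.
Proof.
elim: l => [//|[i x] l IH] /= [Cx hl rl] _.
have [k ->] : exists k : int, sg x = 2 * k + 1.
  have [/sg_pos ->|[//|/sg_neg ->]] := cone_trichotomy x; first by exists 0.
  by exists (-1).
case: l hl rl IH => [|t l] hl rl IH /=.
  by exists k; rewrite turnx0; lia.
have [k' /= ->] := IH rl (fun e => ltac:(discriminate e)).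
have [->|->] := turn_odd hl; [exists (k + k' + 1) | exists (k + k')]; lia.
Qed.

Lemma gtau_odd g : (exists c, g = jC c) \/ exists k : int, gtau g = 2 * k + 1.
Proof.
have [[|t l] gl] := word_exists g.
  by left; case: gl => _ [c ->]; exists c; rewrite gmul1.
by right; rewrite (gtauE gl); apply: tau_odd => //; case: gl.
Qed.

(** * The left-order on the product with the integers *)

Section Order.
Variable PC : C -> Prop.
Hypothesis conePC : positive_cone PC.

Definition pos (p : prodZ G) : Prop :=
  0 < gtau p.1 + 2 * p.2 \/ p.2 = 0 /\ exists2 c, PC c & p.1 = jC c.

(** Two positive integers add up to at least 2, so the defect 1 leaves a positive value; factors
    from [C] leave [gtau] unchanged. *)
Lemma posM p q : pos p -> pos q -> pos (p ** q).
Proof.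
case: p q => [g m] [h k]; rewrite /pos /=.
have [PCM _] := conePC.
move=> [gp|[-> [c Pc ->]]] [hp|[-> [d Pd ->]]].
- by left; have := gtauM_bound g h; lia.
- by left; rewrite gtau_mulC addr0.
- by left; rewrite gtau_Cmul add0r.
- by right; split=> //; exists (c ** d); [apply: PCM | rewrite jC_hom].
Qed.

Lemma pos1 : ~ pos (gone (prodZ G)).
Proof.
have [_ [_ [PC1 _]]] := conePC.
rewrite /pos /= -(hom1 jC_hom) gtau_jC => -[//|[_ [c Pc /jC_inj e]]].
exact: (PC1 c Pc).
Qed.

(** Parity keeps [gtau g + 2 * m] away from 0 outside [C]; on [C] it vanishes only for [m = 0],
    where [PC] decides. *)
Lemma pos_total p : p <> gone (prodZ G) -> pos p \/ pos (ginv p).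
Proof.
have [_ [PCt _]] := conePC.
case: p => [g m] ne; rewrite /pos /= gtau_inv.
have [gt0|le0] := boolP (0 < gtau g + 2 * m); first by left; left.
have [lt0|ge0] := boolP (gtau g + 2 * m < 0); first by right; left; lia.
have [[c gc]|[k Tk]] := gtau_odd g; last lia.
have m0 : m = 0 by move: ge0 le0; rewrite gc gtau_jC; lia.
have [Pc|[c1|Pc]] := PCt c.
- by left; right; split=> //; exists c.
- by case: ne; rewrite m0 gc c1 (hom1 jC_hom).
- right; right; rewrite m0 oppr0; split=> //; exists (ginv c) => //.
  by rewrite gc (homV _ jC_hom).
Qed.

Lemma pos_left_order : left_order (fun x y : prodZ G => pos (ginv x ** y)).
Proof.
split; first by move=> x; rewrite gmulV; apply: pos1.
split; first by move=> x y z xy yz; have := posM xy yz; rewrite gmulA gmulgK.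
split=> [x y ne|g x y]; last by rewrite ginvM -gmulA gmulKV.
have [e|p|] := @pos_total (ginv x ** y); [|by left|].
  by case: ne; rewrite -[y](gmulVK x) e gmulg1.
by rewrite ginvM ginvK; right.
Qed.

(** * A finite graph with rational labels for the positive cone *)

Hypothesis P_rational : forall i, rational (@P i).
Hypothesis PC_rational : rational PC.
Hypothesis Gi_rational : forall i, rational (fun _ : Gi i => True).
Hypothesis C_rational : rational (fun _ : C => True).

Definition pairZ (g : G) (m : int) : prodZ G := (g, m).

Lemma pairZM g h m k : pairZ g m ** pairZ h k = pairZ (g ** h) (m + k).
Proof. by []. Qed.

Lemma rational_pairZ (H : group) (f : H -> G) (S : H -> Prop) (m : int) :
  is_hom f -> rational S ->
  rational (fun p : prodZ G => exists2 x, S x & p = pairZ (f x) m).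
Proof.
move=> fM rS; pose f0 x := pairZ (f x) 0.
have f0M : is_hom f0 by move=> x y; rewrite /f0 pairZM addr0 fM.
apply: rational_ext (rational_image (pairZ (gone G) m) f0M rS) => p.
by split=> -[x Sx ->]; exists x => //; rewrite pairZM add0r gmulg1.
Qed.

Definition signed_cone i (b : bool) (x : Gi i) : Prop := if b then P x else P (ginv x).
Definition bsg (b : bool) : int := if b then 1 else -1.

Lemma signed_cone_sg i b (x : Gi i) : signed_cone b x -> sg x = bsg b.
Proof. by case: b => [/sg_pos|/sg_neg]. Qed.

Lemma signed_coneP i (x : Gi i) : ~ inC x -> exists b, signed_cone b x.
Proof.
have [Px|[//|Px]] := cone_trichotomy x; [by exists true | by exists false].
Qed.

Lemma signed_cone_notC i b (x : Gi i) : signed_cone b x -> ~ inC x.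
Proof. by case: b => [/cone_notC|/cone_notC]; rewrite ?inCVE. Qed.

(* The power of the generator of [Z] that cancels the (even) contribution to [tau l + 2 m] of a
   syllable of sign [b] in [G_i] preceded by a syllable in [G_k]; for a first syllable it
   brings the total to [1]. *)
Definition shift (o : option 'I_n) (i : 'I_n) (b : bool) : int :=
  if o is Some k then
    if (k < i)%N then (if b then -1 else 0) else (if b then 0 else 1)
  else (if b then 0 else 1).
Arguments shift : simpl never.

Lemma shift_None i b : 2 * shift None i b + bsg b = 1.
Proof. by case: b. Qed.

Lemma shift_Some k i b : Some k <> Some i ->
  2 * shift (Some k) i b + bsg b + turn (Some k) (Some i) = 0.
Proof.
move=> ne; rewrite /shift /turn; case: ltngtP => [||e]; try by case: b.
by case: ne; congr Some; apply: val_inj.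
Qed.

Notation pstate := ('I_n + bool)%type.
Notation pedge := ((option 'I_n * 'I_n * bool) + ('I_n + option bool))%type.
Notation start := (inr false : pstate).
Notation fin := (inr true : pstate).

(** The edge [inl (o, i, b)] reads a syllable of sign [b] in [Gi i] after one of index [o];
    [inr (inl i)] reads the final factor from [C]; [inr (inr None)] loops at [fin] to raise the
    exponent; the last two edges handle elements of [C]. *)
Definition psrc (e : pedge) : pstate := match e with
  | inl (Some k, _, _) => inl k
  | inl (None, _, _) => start
  | inr (inl i) => inl i
  | inr (inr None) => fin
  | inr (inr (Some _)) => start
  end.

Definition ptgt (e : pedge) : pstate := match e with
  | inl (_, i, _) => inl i
  | inr _ => fin
  end.

Definition plab (e : pedge) (p : prodZ G) : Prop := match e with
  | inl (o, i, b) =>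
      o <> Some i /\ exists2 x : Gi i, signed_cone b x & p = pairZ (j x) (shift o i b)
  | inr (inl _) => exists2 c, True & p = pairZ (jC c) 0
  | inr (inr None) => p = pairZ (gone G) 1
  | inr (inr (Some true)) => exists2 c, True & p = pairZ (jC c) 1
  | inr (inr (Some false)) => exists2 c, PC c & p = pairZ (jC c) 0
  end.

(** The invariant of a state: what can be read from it to [fin]. At [inl i] the bound is weak, since
    the first syllable has already brought the total to 1. *)
Definition accepted (q : pstate) (p : prodZ G) : Prop := match q with
  | inl i => exists l c, [/\ reduced l, hd l <> Some i, p.1 = ev l ** jC c &
                             0 <= 2 * p.2 + turn (Some i) (hd l) + tau l]
  | inr true => p.1 = gone G /\ 0 <= p.2
  | inr false => pos p
  end.

Lemma plab_rational e : rational (plab e).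
Proof.
case: e => [[[o i] b]|[i|[[]|]]] /=.
- have [->|ne] := eqVneq o (Some i).
    by apply: rational_ext (rational_empty _) => p; split=> // -[].
  apply: rational_ext (rational_pairZ (S := signed_cone b) (shift o i b)
    (j_hom (i := i)) _).
    by move=> p; split=> [|[]] //; split=> //; apply/eqP.
  case: b; first exact: P_rational.
  exact: (rational_inv (P_rational i)).
- exact: (rational_pairZ _ jC_hom).
- exact: (rational_pairZ _ jC_hom).
- exact: (rational_pairZ _ jC_hom).
- exact: rational1.
Qed.

Lemma gpath_accepted q p : gpath psrc ptgt plab fin q p -> accepted q p.
Proof.
elim=> // e a h; case: e => [[[o i] b]|[i|[[]|]]].
- move=> /= [oi [x bx ->]] _ [l [c [rl hl eh ineq]]].
  have sx := signed_cone_sg bx.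
  have rw : reduced (Tagged Gi x :: l).
    by split=> //; apply: signed_cone_notC bx.
  have ew : j x ** h.1 = ev (Tagged Gi x :: l) ** jC c by rewrite /= eh gmulA.
  (* A later syllable with its shift leaves the surplus unchanged; a first one raises it by 1, from
     nonnegative to positive. *)
  case: o oi => [k|] oi /=.
    exists (Tagged Gi x :: l), c; split=> //=; first by move=> e; case: oi.
    have := shift_Some b oi; rewrite sx; lia.
  left=> /=; rewrite (@gtauE _ (Tagged Gi x :: l)); last by split=> //; exists c.
  have := shift_None i b; rewrite /= sx; lia.
- move=> /= [c _ ->] _ [-> m0]; exists [::], c; split=> //=.
    by rewrite gmulg1 gmul1.
  rewrite turnx0; lia.
- move=> /= [c _ ->] _ [h1 m0]; left; rewrite /= h1 gmulg1 gtau_jC; lia.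
- move=> /= [c Pc ->] _ [h1 m0].
  (* If the loops at [fin] contributed anything, the exponent alone makes the element positive. *)
  have [m00|m1] := eqVneq h.2 0.
    by right; rewrite /= h1 gmulg1 m00; split=> //; exists c.
  left; rewrite /= h1 gmulg1 gtau_jC; lia.
- move=> /= -> _ [-> m0] /=; rewrite gmul1; split=> //; lia.
Qed.

Lemma gpath_fin (m : int) : 0 <= m ->
  gpath psrc ptgt plab fin fin (pairZ (gone G) m).
Proof.
case: m => // m _; elim: m => [|m IH]; first exact: gpath_nil.
apply: (gpath_step (e := inr (inr None) : pedge) _ _ IH) => //.
by rewrite pairZM gmul1; congr pairZ; lia.
Qed.

(** Every syllable is read with its shift, so the surplus reaches the end unchanged and the loops at
    [fin] absorb it. *)
Lemma gpath_syllables l i c (m : int) : reduced l -> hd l <> Some i ->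
  0 <= 2 * m + turn (Some i) (hd l) + tau l ->
  gpath psrc ptgt plab fin (inl i) (pairZ (ev l ** jC c) m).
Proof.
elim: l i m => [|[k x] l IH] i m /=.
  move=> _ _; rewrite turnx0 => ineq.
  have m0 : 0 <= m by lia.
  apply: (gpath_step (e := inr (inl i) : pedge) (a := pairZ (jC c) 0)
    _ _ (gpath_fin m0)) => //; first by exists c.
  by rewrite pairZM gmul1 gmulg1 add0r.
move=> [Cx hl rl] ik ineq; have [b bx] := signed_coneP Cx.
have {}ik : Some i <> Some k by move=> e; case: ik.
have sh := shift_Some b ik; have sx := signed_cone_sg bx.
have ineq' : 0 <= 2 * (m - shift (Some i) k b) + turn (Some k) (hd l) + tau l.
  by move: ineq; rewrite sx; lia.
apply: (gpath_step (e := inl (Some i, k, b) : pedge)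
  (a := pairZ (j x) (shift (Some i) k b)) _ _ (IH _ _ rl hl ineq')) => //.
  by split=> //; exists x.
by rewrite pairZM gmulA addrC subrK.
Qed.

Lemma gpath_pos p : pos p -> gpath psrc ptgt plab fin start p.
Proof.
case: p => g m; case=> /= [|[-> [c Pc ->]]]; last first.
  apply: (gpath_step (e := inr (inr (Some false)) : pedge)
    (a := pairZ (jC c) 0) _ _ (gpath_fin (m := 0) isT)) => //; first by exists c.
  by rewrite pairZM gmulg1 addr0.
have [[|[i x] l] gw] := word_exists g; rewrite (gtauE gw) /= => ineq.
  have m1 : 0 <= m - 1 by lia.
  case: gw => _ [c]; rewrite gmul1 => ->.
  apply: (gpath_step (e := inr (inr (Some true)) : pedge)
    (a := pairZ (jC c) 1) _ _ (gpath_fin m1)) => //; first by exists c.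
  by rewrite pairZM gmulg1 addrC subrK.
case: gw => -[/= Cx hl rl] [c ->]; have [b bx] := signed_coneP Cx.
have sh := shift_None i b; have sx := signed_cone_sg bx.
have ineq' : 0 <= 2 * (m - shift None i b) + turn (Some i) (hd l) + tau l.
  by move: ineq; rewrite sx; lia.
apply: (gpath_step (e := inl (None, i, b) : pedge)
  (a := pairZ (j x) (shift None i b)) _ _ (gpath_syllables c rl hl ineq')) => //.
  by split=> //; exists x.
by rewrite pairZM gmulA addrC subrK.
Qed.

Lemma pos_rational : rational pos.
Proof.
apply: rational_ext (rational_gpath psrc ptgt start fin plab_rational) => p.
by split; [apply: (@gpath_accepted start) | apply: gpath_pos].
Qed.

(** A graph with one vertex whose loops carry the factors, [C] and the two units of the integers;
    these generate the product as a monoid. *)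
Lemma prodZ_rational : rational (fun _ : prodZ G => True).
Proof.
pose E := ('I_n + option bool)%type.
pose lab (e : E) (p : prodZ G) : Prop := match e with
  | inl i => exists2 x : Gi i, True & p = pairZ (j x) 0
  | inr None => exists2 c, True & p = pairZ (jC c) 0
  | inr (Some b) => p = pairZ (gone G) (bsg b)
  end.
have lab_rational e : rational (lab e).
  case: e => [i|[b|]] /=; last exact: (rational_pairZ _ jC_hom).
    exact: (rational_pairZ _ (j_hom (i := i))).
  exact: rational1.
pose gen := gpath (fun=> tt) (fun=> tt) lab tt tt.
apply: rational_ext (rational_gpath (fun=> tt) (fun=> tt) tt tt lab_rational).
move=> [g m]; split=> // _.
have gen1 e a : lab e a -> gen a.
  move=> la; apply: (gpath_step (e := e) _ la (gpath_nil _ _ _ _)) => //.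
  by rewrite gmulg1.
have genM a b : gen a -> gen b -> gen (a ** b) by apply: gpath_cat.
have genC c : gen (pairZ (jC c) 0) by apply: (gen1 (inr None)); exists c.
have genz (b : bool) (k : nat) : gen (pairZ (gone G) (bsg b * k%:Z)).
  elim: k => [|k IH]; first by rewrite mulr0; apply: gpath_nil.
  have -> : pairZ (gone G) (bsg b * k.+1%:Z) =
      pairZ (gone G) (bsg b) ** pairZ (gone G) (bsg b * k%:Z).
    by rewrite pairZM gmul1; congr pairZ; case: b {IH}; rewrite /bsg; lia.
  by apply: genM => //; apply: (gen1 (inr (Some b))).
have [l [_ [c ->]]] := word_exists g.
have -> : (ev l ** jC c, m) = pairZ (ev l) 0 ** pairZ (jC c) 0 ** pairZ (gone G) m.
  by rewrite !pairZM gmulg1 !add0r.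
apply: (genM); first apply: (genM) => //.
  elim: l => [|[i x] l IH] /=; first exact: gpath_nil.
  rewrite -[0]add0r -pairZM; apply: genM => //.
  by apply: (gen1 (inl i)); exists x.
case: m => k; first by have := genz true k; rewrite mul1r.
by have := genz false k.+1; rewrite NegzE mulN1r.
Qed.

End Order.
End Cones.
End Amalgam.

Theorem theorem5p14 (n : nat) (C : group) (Gi : 'I_n -> group)
    (iota : forall i, C -> Gi i)
    (iota_hom : forall i, is_hom (iota i))
    (iota_inj : forall i, injective (iota i))
    (Gi_fg : forall i, finitely_generated (Gi i))
    (Gi_cone : forall i, exists P : Gi i -> Prop,
        rel_positive_cone (fun g => exists c, iota i c = g) P /\ regular_subset P)
    (C_cone : exists P : C -> Prop, positive_cone P /\ regular_subset P)
    (G : group) (jC : C -> G) (j : forall i, Gi i -> G)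
    (hG : amalgamated_free_product iota jC j) :
  exists lt : prodZ G -> prodZ G -> Prop, regular_left_order lt.
Proof.
pose P i := sval (cid (Gi_cone i)).
have coneP i : rel_positive_cone (@inC _ _ _ iota i) (P i).
  by rewrite /P; case: cid => ? [].
have regP i : regular_subset (P i) by rewrite /P; case: cid => ? [].
have [PC [conePC regPC]] := C_cone.
have ratP i := regular_subset_rational (regP i).
have ratG i := regular_subset_rationalT (regP i).
have ratPC := regular_subset_rational regPC.
have ratC := regular_subset_rationalT regPC.
exists (fun x y => pos iota_hom hG coneP PC (ginv x ** y)).
split; first exact: pos_left_order.
apply: rational_regular_subset; last first.
  exact: (prodZ_rational iota_hom hG coneP).
apply: rational_ext (pos_rational iota_hom iota_inj hG coneP ratP ratPC ratC).
by move=> g; rewrite ginv1 gmul1.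
Qed.
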